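(* A $C^3$ umbilical hypersurface $\Sigma$ of a $C^2$ spacetime $(\mathcal{V},g)$ must have constant signature.
   Context: A $C^2$ spacetime is a $C^3$ manifold with a $C^2$ Lorentzian metric $g$ of signature $(-,+,\dots,+)$. No a priori restriction is placed on the causal character of the hypersurface $\Sigma$, which could in principle vary from point to point. Let $\boldsymbol{n}$ be a $C^2$ normal one-form of $\Sigma$, i.e. a nowhere zero one-form with $\boldsymbol{n}(\vec v)=0$ for every $\vec v$ tangent to $\Sigma$; it is defined only up to multiplication by a nowhere vanishing function. Let $\{\xi^a\}$ be local coordinates on $\Sigma$ and $\vec e_a$ the images in $T\mathcal{V}$ of $\partial/\partial\xi^a$. The first fundamental form is $h_{ab}=g_{\mu\nu}e_a{}^\mu e_b{}^\nu$ and the second fundamental form is $K_{ab}=e_a{}^\mu e_b{}^\nu\nabla_\mu n_\nu$, where $\nabla$ is the Levi-Civita connection of $g$. The hypersurface $\Sigma$ is called umbilical if its second fundamental form is proportional to its first fundamental form, $K_{ab}=F\,h_{ab}$ for some function $F$ on $\Sigma$ (rescaling $\boldsymbol n$ rescales $K_{ab}$ by the same factor, so this does not depend on the choice of $\boldsymbol n$). $\Sigma$ is spacelike, null or timelike at a point according to whether $g^{\mu\nu}n_\mu n_\nu$ is negative, zero or positive there; correspondingly $h$ is positive definite, degenerate or Lorentzian there. Constant signature means that the causal character of $\Sigma$ does not change: it is spacelike everywhere, timelike everywhere, or null everywhere.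
   Formalization: The hypersurface Σ is assumed connected (a disjoint union of spacelike and timelike hyperplane pieces is a counterexample otherwise), and when Σ is one-dimensional the umbilicity function F is required continuous (else x = t + t³ in the Minkowski plane is a counterexample). *)

(* Defs.v *)
From HB Require Import structures.
From mathcomp Require Import all_boot all_order all_algebra.
From mathcomp Require Import all_classical all_reals all_analysis.

Set Implicit Arguments.
Unset Strict Implicit.
Unset Printing Implicit Defensive.

Import Order.TTheory GRing.Theory Num.Theory.
Import numFieldNormedType.Exports.

Local Open Scope classical_set_scope.
Local Open Scope ring_scope.

(* Throughout, vectors and covectors are row vectors of components, and the
   model spaces are 'rV[R]_n.+1: a manifold "with parameter n" has dimension
   n.+1. *)

Section Calculus.
Context {R : realType}.

Definition partial n (a : 'I_n.+1) (f : 'rV[R]_n.+1 -> R) : 'rV[R]_n.+1 -> R :=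
  fun x => 'D_(delta_mx 0 a) f x.

(* Meant for open A. *)
Fixpoint Ck n (k : nat) (A : set 'rV[R]_n.+1) (f : 'rV[R]_n.+1 -> R) : Prop :=
  (forall x, A x -> {for x, continuous f}) /\
  match k with
  | 0 => True
  | k'.+1 => forall a : 'I_n.+1,
      (forall x, A x -> derivable f x (delta_mx 0 a)) /\ Ck k' A (partial a f)
  end.

Definition Ck_map n p (k : nat) (A : set 'rV[R]_n.+1)
    (f : 'rV[R]_n.+1 -> 'rV[R]_p) : Prop :=
  forall j : 'I_p, Ck k A (fun x => f x 0 j).

(* Row a is the image of the a-th coordinate vector. *)
Definition jac n p (f : 'rV[R]_n.+1 -> 'rV[R]_p) (x : 'rV[R]_n.+1) :
    'M[R]_(n.+1, p) :=
  \matrix_(a, j) partial a (fun y => f y 0 j) x.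

End Calculus.

Section Manifolds.
Context {R : realType}.

(* [coord] is only meaningful on [dom], and [pt], its inverse, on the image. *)
Record chart (T : topologicalType) (n : nat) := Chart {
  dom : set T;
  coord : T -> 'rV[R]_n.+1;
  pt : 'rV[R]_n.+1 -> T;
  dom_open : open dom;
  img_open : open (coord @` dom);
  coordK : forall p, dom p -> pt (coord p) = p;
  coord_cts : forall p, dom p -> {for p, continuous coord};
  pt_cts : forall x, (coord @` dom) x -> {for x, continuous pt}
}.

Definition local_rep (S T : topologicalType) m n (f : S -> T)
    (d : chart S m) (c : chart T n) : 'rV[R]_m.+1 -> 'rV[R]_n.+1 :=
  coord c \o f \o pt d.

Record manifold (k : nat) (T : topologicalType) (n : nat) := Manifold {
  atlas : set (chart T n);
  atlas_cover : forall p : T, exists2 c, atlas c & dom c p;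
  atlas_compat : forall c c', atlas c -> atlas c' ->
    Ck_map k (coord c @` (dom c `&` dom c')) (local_rep idfun c c');
  manifold_hausdorff : hausdorff_space T;
  manifold_second_countable : @second_countable T
}.

(* [trans c c' p] mu nu is dx'^nu / dx^mu at p. *)
Definition trans (T : topologicalType) n (c c' : chart T n) (p : T) :
    'M[R]_n.+1 :=
  jac (local_rep idfun c c') (coord c p).

End Manifolds.

Section Spacetime.
Context {R : realType}.

Definition minkowski n : 'M[R]_n.+1 :=
  diag_mx (\row_i (if i == ord0 then -1 else 1)).

Definition lorentzian n (G : 'M[R]_n.+1) : Prop :=
  G^T = G /\ exists2 P, P \in unitmx & P *m G *m P^T = minkowski n.

(* [metric c p] is the matrix of components g_{mu nu} at p in the chart c. *)
Record lorentz_metric (k : nat) (T : topologicalType) n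
    (M : manifold (R := R) k.+1 T n) := LorentzMetric {
  metric : chart (R := R) T n -> T -> 'M[R]_n.+1;
  metric_lorentzian : forall c p, atlas M c -> dom c p ->
    lorentzian (metric c p);
  metric_change : forall c c' p, atlas M c -> atlas M c' ->
    dom c p -> dom c' p ->
    metric c p = trans c c' p *m metric c' p *m (trans c c' p)^T;
  metric_Ck : forall c (mu nu : 'I_n.+1), atlas M c ->
    Ck k (coord c @` dom c) (fun x => metric c (pt c x) mu nu)
}.

(* Gamma^rho_{mu nu} of the Levi-Civita connection. *)
Definition christoffel k (T : topologicalType) n
    (M : manifold (R := R) k.+1 T n) (g : lorentz_metric M)
    (c : chart T n) (p : T) (rho mu nu : 'I_n.+1) : R :=
  let dg s a b := partial s (fun x => metric g c (pt c x) a b) (coord c p) in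
  2^-1 * \sum_(s < n.+1) invmx (metric g c p) rho s *
    (dg mu s nu + dg nu s mu - dg s mu nu).

End Spacetime.

Section Hypersurface.
Context {R : realType}.

(* A hypersurface is given by a C^k immersion of codimension one, so that
   embedded hypersurfaces (with [emb] the inclusion) are a special case. *)
Record hypersurface (k : nat) (T : topologicalType) m
    (M : manifold (R := R) k T m.+1) (S : topologicalType) := Hypersurface {
  hyp_manifold : manifold (R := R) k S m;
  emb : S -> T;
  emb_cts : continuous emb;
  emb_Ck : forall d c, atlas hyp_manifold d -> atlas M c ->
    Ck_map k (coord d @` (dom d `&` emb @^-1` dom c)) (local_rep emb d c);
  emb_rank : forall d c q, atlas hyp_manifold d -> atlas M c ->
    dom d q -> dom c (emb q) ->
    row_free (jac (local_rep emb d c) (coord d q))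
}.

Variables (V S : topologicalType) (m : nat) (M : manifold (R := R) 3 V m.+1).
Variables (g : lorentz_metric (k := 2) M) (H : hypersurface M S).

Definition charts_at (d : chart S m) (c : chart V m.+1) (q : S) : Prop :=
  [/\ atlas (hyp_manifold H) d, atlas M c, dom d q & dom c (emb H q)].

(* Row a is e_a^mu. *)
Definition tangent_frame d c (q : S) : 'M[R]_(m.+1, m.+2) :=
  jac (local_rep (emb H) d c) (coord d q).

Definition first_form d c (q : S) : 'M[R]_m.+1 :=
  let e := tangent_frame d c q in e *m metric g c (emb H q) *m e^T.

Definition normal_covector d c (q : S) (w : 'rV[R]_m.+2) : Prop :=
  w != 0 /\ tangent_frame d c q *m w^T = 0.

(* A C^2 normal one-form along the open subset U of the hypersurface; [n c q]
   is the row of components n_mu at q in the spacetime chart c. *)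
Definition normal_form (U : set S) (n : chart V m.+1 -> S -> 'rV[R]_m.+2) :
    Prop :=
  [/\ forall d c q, U q -> charts_at d c q -> normal_covector d c q (n c q),
      forall c c' q, U q -> atlas M c -> atlas M c' ->
        dom c (emb H q) -> dom c' (emb H q) ->
        n c q = n c' q *m (trans c c' (emb H q))^T
    & forall d c, atlas (hyp_manifold H) d -> atlas M c ->
        Ck_map 2 (coord d @` (dom d `&` emb H @^-1` dom c `&` U))
          (fun xi => n c (pt d xi))].

(* e_a^mu nabla_mu n_nu, the covariant derivative along the hypersurface: as n
   is only defined there, e_a^mu d_mu n_nu is the derivative of n_nu with
   respect to xi^a. *)
Definition cov_deriv (n : chart V m.+1 -> S -> 'rV[R]_m.+2) d c (q : S)
    (a : 'I_m.+1) (nu : 'I_m.+2) : R :=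
  partial a (fun xi => n c (pt d xi) 0 nu) (coord d q) -
  \sum_(mu < m.+2) \sum_(rho < m.+2)
    christoffel g c (emb H q) rho mu nu * tangent_frame d c q a mu * n c q 0 rho.

Definition second_form n d c (q : S) : 'M[R]_m.+1 :=
  \matrix_(a, b) \sum_(nu < m.+2)
    tangent_frame d c q b nu * cov_deriv n d c q a nu.

(* The normal one-form is only asked to exist locally, so that two-sidedness is
   not imposed. If the hypersurface has dimension at least 2 (0 < m), then h
   vanishes nowhere and F is automatically continuous. On a curve, K = F h is
   empty at the non-null points and says K = 0 at the null ones, unless F is
   asked to be continuous: in the Minkowski plane with coordinates (t, x), the
   curve x = t + t^3 is null exactly at t = 0, has K = 0 there, and F = K / h
   is unbounded near that point. *)
Definition umbilical : Prop :=
  forall q0 : S, exists U : set S,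
  exists n : chart V m.+1 -> S -> 'rV[R]_m.+2, exists F : S -> R,
  [/\ open U /\ U q0,
      normal_form U n,
      forall d c q, U q -> charts_at d c q ->
        second_form n d c q = F q *: first_form d c q
    & m = 0%N -> forall q, U q -> {for q, continuous F}].

Definition conormal_norm (c : chart V m.+1) (q : S) (w : 'rV[R]_m.+2) : R :=
  (w *m invmx (metric g c (emb H q)) *m w^T) 0 0.

Definition spacelike_at (q : S) : Prop :=
  forall d c w, charts_at d c q -> normal_covector d c q w ->
    conormal_norm c q w < 0.

Definition null_at (q : S) : Prop :=
  forall d c w, charts_at d c q -> normal_covector d c q w ->
    conormal_norm c q w = 0.

Definition timelike_at (q : S) : Prop :=
  forall d c w, charts_at d c q -> normal_covector d c q w ->
    0 < conormal_norm c q w.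

Definition constant_signature : Prop :=
  [\/ forall q, spacelike_at q, forall q, timelike_at q
    | forall q, null_at q].

End Hypersurface.

(* Main.v *)
(* Let n be a normal one-form and N = g^{-1}(n, n). If l is a transversal
   vector with s = n(l) nonzero, then n^# - (N/s) l is annihilated by n, hence
   tangent. Umbilicity turns the contraction of this tangent vector with K into
   one with h, so that
     d_a N = 2 n^#.(nabla_a n) = N * (2/s) (l.(nabla_a n) - F g(e_a, l)).
   The factor of N is continuous (F = K_ab / h_ab near a point where h_ab is
   nonzero), so this linear system forces N to vanish near each of its zeros:
   {N = 0} is open, like {N < 0} and {N > 0}, and Sigma is connected. *)

Require Import Defs.
From HB Require Import structures.
From mathcomp Require Import all_boot all_order all_algebra.
From mathcomp Require Import all_classical all_reals all_analysis.
From mathcomp Require Import ring lra.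

Set Implicit Arguments.
Unset Strict Implicit.
Unset Printing Implicit Defensive.

Import Order.TTheory GRing.Theory Num.Theory.
Import numFieldNormedType.Exports.

Local Open Scope classical_set_scope.
Local Open Scope ring_scope.

(** The obstacle is the null point: there [n^#] is itself tangent and [h] is degenerate, so neither
    the orthogonal splitting along the normal nor the inverse of [h] is available. This is why an
    auxiliary [l] enters, and why only the inverse of the full metric occurs. The identity for
    [d_a N] is obtained as matrix algebra over the coordinate domain of the hypersurface, with the
    vanishing of [nabla g] in the form [dG = Gam G + (Gam G)^T].

    The coefficient of [N] is controlled only through its continuity at the zero in question. A mean
    value estimate suffices there, since it asks no more than a bound on the coefficient near that
    point.

    A rank count shows that [h] has a nonzero entry as soon as the hypersurface has dimension at
    least 2. On a curve [h] does vanish at null points, and the continuity of [F] is then taken from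
    the definition of [umbilical].

    [N] depends on the local normal, but two choices differ by the square of a nonzero factor. Only
    its sign is global, so connectedness is applied to three sign conditions and not to a
    function. *)

Section MatrixCalculus.
Context {R : realType}.

Lemma cvg_mxP (T : Type) (F : set_system T) {FF : Filter F} m n
    (f : T -> 'M[R]_(m, n)) (l : 'M[R]_(m, n)) :
  f @ F --> l <-> forall i j, (fun x => f x i j) @ F --> l i j.
Proof.
split=> [fl i j|fl].
  exact: (cvg_comp _ _ fl (@coord_continuous R m n i j l)).
apply/cvg_ballP => e e0.
have : \forall x \near F, forall ij : 'I_m * 'I_n,
    ball (l ij.1 ij.2) e (f x ij.1 ij.2).
  by apply: filter_forall => ij; by have /cvg_ballP := fl ij.1 ij.2; exact.
by apply: filterS => x fx; split=> // i j; exact: (fx (i, j)).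
Qed.

Lemma cvg_mx_coord (T : Type) (F : set_system T) {FF : Filter F} m n
    (f : T -> 'M[R]_(m, n)) (l : 'M[R]_(m, n)) i j :
  f @ F --> l -> (fun x => f x i j) @ F --> l i j.
Proof. by move=> /cvg_mxP. Qed.

Lemma cvg_mulmx (T : Type) (F : set_system T) {FF : Filter F} m n p
    (f : T -> 'M[R]_(m, n)) (g : T -> 'M[R]_(n, p))
    (l : 'M[R]_(m, n)) (k : 'M[R]_(n, p)) :
  f @ F --> l -> g @ F --> k -> (fun x => f x *m g x) @ F --> l *m k.
Proof.
move=> /cvg_mxP fl /cvg_mxP gk; apply/cvg_mxP => i j.
under eq_fun do rewrite mxE; rewrite mxE.
by apply: (cvg_big add_continuous) => s _; apply: cvgM; [exact: fl|exact: gk].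
Qed.

Lemma cvg_trmx (T : Type) (F : set_system T) {FF : Filter F} m n
    (f : T -> 'M[R]_(m, n)) (l : 'M[R]_(m, n)) :
  f @ F --> l -> (fun x => (f x)^T) @ F --> l^T.
Proof.
move=> /cvg_mxP fl; apply/cvg_mxP => i j.
by under eq_fun do rewrite mxE; rewrite mxE; exact: fl.
Qed.

Lemma cvg_det (T : Type) (F : set_system T) {FF : Filter F} n
    (f : T -> 'M[R]_n) (l : 'M[R]_n) :
  f @ F --> l -> (fun x => \det (f x)) @ F --> \det l.
Proof.
move=> /cvg_mxP fl; rewrite /determinant.
apply: (cvg_big add_continuous) => s _; apply: cvgM; first exact: cvg_cst.
by apply: (cvg_big mul_continuous) => i _; exact: fl.
Qed.

(** By Cramer's formula the inverse is the adjugate divided by the determinant. [invmx] follows this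
    formula only on invertible matrices, so the nonvanishing of the determinant near the limit has
    to be established first. *)
Lemma cvg_invmx (T : Type) (F : set_system T) {FF : Filter F} n
    (f : T -> 'M[R]_n) (l : 'M[R]_n) :
  l \in unitmx -> f @ F --> l -> (fun x => invmx (f x)) @ F --> invmx l.
Proof.
move=> ul fl; have dl : (fun x => \det (f x)) @ F --> \det l by exact: cvg_det.
have dl0 : \det l != 0 by rewrite unitmxE unitfE in ul.
have nz : \forall x \near F, \det (f x) != 0.
  exact: cvgr_neq0 dl dl0.
have : (fun x => (\det (f x))^-1 *: \adj (f x)) @ F --> (\det l)^-1 *: \adj l.
  apply/cvg_mxP => i j; under eq_fun do rewrite !mxE; rewrite !mxE.
  apply: cvgM; first exact: cvgV.
  apply: cvgM; first exact: cvg_cst.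
  apply: cvg_det; apply/cvg_mxP => a b.
  under eq_fun do rewrite !mxE; rewrite !mxE.
  exact: ((cvg_mxP f l).1 fl).
rewrite /(invmx l) ul; apply: cvg_trans; apply: near_eq_cvg.
by apply: filterS nz => x nz; rewrite /invmx unitmxE unitfE nz.
Qed.

(** A directional derivative gives continuity along its own line, which is what the product and
    inverse rules below use. *)
Lemma derivable_cvg (V W : normedModType R) (f : V -> W) x v :
  derivable f x v -> (fun h : R => f (h *: v + x)) @ 0^' --> f x.
Proof.
move=> /derivable1P/derivable1_diffP/differentiable_continuous fc.
have {2}-> : x = 0 *: v + x by rewrite scale0r add0r.
exact: cvg_within_filter fc.
Qed.

Lemma is_derive_cvg (V W : normedModType R) (f : V -> W) x v df :
  (fun h : R => h^-1 *: (f (h *: v + x) - f x)) @ 0^' --> df ->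
  is_derive x v f df.
Proof.
by move=> fd; split; [apply/cvg_ex; exists df|apply/cvg_lim].
Qed.

Lemma cvg_is_derive (V W : normedModType R) (f : V -> W) x v df :
  is_derive x v f df ->
  (fun h : R => h^-1 *: (f (h *: v + x) - f x)) @ 0^' --> df.
Proof. by case=> /cvg_ex [l fl] <-; rewrite /derive (cvg_lim _ fl). Qed.

Lemma is_derive_mulmx (V : normedModType R) m n p (f : V -> 'M[R]_(m, n))
    (g : V -> 'M[R]_(n, p)) x v df dg :
  is_derive x v f df -> is_derive x v g dg ->
  is_derive x v (fun y => f y *m g y) (df *m g x + f x *m dg).
Proof.
move=> fd gd; apply: is_derive_cvg.
have fx : (fun h : R => f (h *: v + x)) @ 0^' --> f x.
  by apply: derivable_cvg; case: fd.
rewrite addrC; under eq_fun => h.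
  have -> : f (h *: v + x) *m g (h *: v + x) - f x *m g x =
    f (h *: v + x) *m (g (h *: v + x) - g x) + (f (h *: v + x) - f x) *m g x.
    by rewrite mulmxBr mulmxBl addrA subrK.
  rewrite scalerDr scalemxAr scalemxAl; over.
apply: cvgD; apply: cvg_mulmx => //; [exact: cvg_is_derive| |exact: cvg_cst].
exact: cvg_is_derive.
Qed.

Lemma is_derive_trmx (V : normedModType R) m n (f : V -> 'M[R]_(m, n)) x v df :
  is_derive x v f df -> is_derive x v (fun y => (f y)^T) df^T.
Proof.
move=> fd; apply: is_derive_cvg.
under eq_fun do rewrite -linearB/= -linearZ/=.
by apply: cvg_trmx; exact: cvg_is_derive.
Qed.

Lemma is_derive_invmx (V : normedModType R) n (f : V -> 'M[R]_n) x v df :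
  f x \in unitmx -> is_derive x v f df ->
  is_derive x v (fun y => invmx (f y)) (- (invmx (f x) *m df *m invmx (f x))).
Proof.
move=> ux fd; apply: is_derive_cvg.
have fx : (fun h : R => f (h *: v + x)) @ 0^' --> f x.
  by apply: derivable_cvg; case: fd.
have nz : \forall h \near 0^', f (h *: v + x) \in unitmx.
  have dl0 : \det (f x) != 0 by rewrite unitmxE unitfE in ux.
  apply: filterS (cvgr_neq0 _ (cvg_det fx) dl0) => h nz.
  by rewrite unitmxE unitfE.
(* The identity [A^-1 - B^-1 = - A^-1 (A - B) B^-1] turns the difference quotient of the inverse
   into a product whose factors all have limits. *)
have : (fun h : R => - (invmx (f (h *: v + x)) *m
    (h^-1 *: (f (h *: v + x) - f x)) *m invmx (f x))) @ 0^' -->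
    - (invmx (f x) *m df *m invmx (f x)).
  apply: cvgN; apply: cvg_mulmx; last exact: cvg_cst.
  by apply: cvg_mulmx; [exact: cvg_invmx|exact: cvg_is_derive].
apply: cvg_trans; apply: near_eq_cvg; apply: filterS nz => h uh.
rewrite -scalemxAr -scalemxAl -scalerN mulmxBr mulmxBl mulVmx // mul1mx.
by rewrite -mulmxA mulmxV // mulmx1 opprB.
Qed.

End MatrixCalculus.

Lemma differentiable_near (R : realType) (V W : normedModType R) (f : V -> W)
    (df : {linear V -> W}) x :
  continuous df ->
  (forall e, 0 < e ->
    \forall h \near 0, `|f (h + x) - (f x + df h)| <= e * `|h|) ->
  differentiable f x.
Proof.
move=> dfc fE.
have E : f \o shift x = cst (f x) + df +o_ 0 id.
  by apply/eqaddoP => e e0; exact: fE.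
by apply/diff_locallyP; rewrite (diff_unique dfc E).
Qed.

(** * Mean value estimates, the chain rule, and uniqueness for a linear first-order system *)

Section PartialDerivatives.
Context {R : realType} {n : nat}.
Implicit Types (f : 'rV[R]_n.+1 -> R) (x y v : 'rV[R]_n.+1).

(** Bounding [c] by [|t|], instead of placing it between 0 and [t], gives one statement for both
    signs of [t]. *)
Lemma mean_value_line f y v (t : R) :
  (forall c : R, `|c| <= `|t| -> derivable f (c *: v + y) v) ->
  exists2 c : R, `|c| <= `|t| &
    f (t *: v + y) - f y = t * 'D_v f (c *: v + y).
Proof.
move=> fd.
pose g (s : R) := f (s *: v + y); pose dg (s : R) := 'D_v f (s *: v + y).
have gd (s : R) : `|s| <= `|t| -> is_derive s 1 g (dg s).
  move=> /fd/derivableP/cvg_is_derive fs; apply: is_derive_cvg.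
  apply: cvg_trans fs; apply: near_eq_cvg; near=> h.
  by rewrite /g [_%:A]mulr1 scalerDl addrA.
have gc (a b : R) : `|a| <= `|t| -> `|b| <= `|t| ->
    {within `[a, b], continuous g}.
  move=> at1 bt; apply: derivable_within_continuous => s.
  rewrite in_itv /= => /andP[as1 sb]; case: (gd s) => //.
  move: at1 bt; rewrite !ler_norml => /andP[? ?] /andP[? ?].
  by apply/andP; split; lra.
have g0 : g 0 = f y by rewrite /g scale0r add0r.
have [t0|t0] := leP 0 t.
- have [|||c] := @MVT_segment R g dg 0 t => //.
  + move=> s; rewrite in_itv /= => /andP[s0 st]; apply: gd.
    by rewrite !ger0_norm // ltW.
  + by apply: gc; rewrite ?normr0.
  rewrite in_itv /= => /andP[c0 ct]; rewrite g0 subr0 => gE.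
  by exists c; [rewrite !ger0_norm|rewrite mulrC].
- have [|||c] := @MVT_segment R g dg t 0 => //; first exact: ltW.
  + move=> s; rewrite in_itv /= => /andP[s0 st]; apply: gd.
    by rewrite !ler0_norm ?lerN2 // ltW.
  + by apply: gc; rewrite ?normr0.
  rewrite in_itv /= => /andP[c0 ct]; rewrite g0 sub0r => gE.
  exists c; first by rewrite !ler0_norm ?lerN2 // ltW.
  by rewrite -opprB [f y - _]gE mulrN opprK mulrC.
Unshelve. all: by end_near. Qed.

(** Consecutive points differ in a single coordinate, so that one partial derivative accounts for
    each step from [x] to [y]. *)
Definition staircase x y (k : nat) : 'rV[R]_n.+1 :=
  \row_i (if (i < k)%N then y 0 i else x 0 i).

Lemma normr_rV_le x (r : R) :
  0 <= r -> (`|x| <= r) = [forall i, `|x 0 i| <= r].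
Proof.
move=> r0; rewrite [`|x|]/Num.Def.normr /= mx_normrE.
apply/bigmax_leP/forallP => [[_ xr] i|xr]; first exact: (xr (0, i)).
by split=> // -[i j] _; rewrite (ord1 i) /=.
Qed.

Lemma normr_coord_le x i : `|x 0 i| <= `|x|.
Proof. by have := lexx `|x|; rewrite {1}normr_rV_le // => /forallP. Qed.

(** The increment telescopes along the staircase. The norm is the maximum norm, so changing
    coordinates one at a time from [x] towards [y] never leaves the cube of radius [|y - x|] about
    [x]. *)
Lemma mean_value_partial f x y :
  (forall z, `|z - x| <= `|y - x| ->
     forall a, derivable f z (delta_mx 0 a)) ->
  exists z : 'I_n.+1 -> 'rV[R]_n.+1,
    (forall a, `|z a - x| <= `|y - x|) /\
    f y - f x = \sum_a (y 0 a - x 0 a) * partial a f (z a).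
Proof.
move=> fd.
have step (a : 'I_n.+1) : exists2 z, `|z - x| <= `|y - x| &
    f (staircase x y a.+1) - f (staircase x y a) =
    (y 0 a - x 0 a) * partial a f z.
  have inbox (c : R) : `|c| <= `|y 0 a - x 0 a| ->
      `|c *: delta_mx 0 a + staircase x y a - x| <= `|y - x|.
    move=> cle; rewrite normr_rV_le //; apply/forallP => i.
    rewrite !mxE eqxx /=.
    have := normr_coord_le (y - x) i; rewrite !mxE.
    have [->|ia] := eqVneq i a.
      by rewrite ltnn mulr1 addrK; exact: le_trans.
    rewrite mulr0 add0r; case: ifP => // _ _.
    by rewrite subrr normr0.
  have [c cle E] := @mean_value_line f (staircase x y a) (delta_mx 0 a)
    (y 0 a - x 0 a) (fun c cle => fd _ (inbox c cle) a).
  exists (c *: delta_mx 0 a + staircase x y a); first exact: inbox.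
  rewrite /partial -E; congr (f _ - _); apply/rowP => i; rewrite !mxE eqxx /=.
  rewrite ltnS leq_eqVlt; have [->|ia] := eqVneq i a.
    by rewrite eqxx /= ltnn mulr1 subrK.
  by rewrite mulr0 add0r -[(i == a :> nat)]/(i == a) (negbTE ia).
have [z zP] := choice (fun a => let: ex_intro2 z p q := step a in
  ex_intro (fun z => _ /\ _) z (conj p q)).
exists z; split=> [a|]; first by case: (zP a).
under eq_bigr => a _ do rewrite -(zP a).2.
rewrite -(big_mkord xpredT
  (fun k => f (staircase x y k.+1) - f (staircase x y k))) telescope_sumr //.
by congr (f _ - f _); apply/rowP => i; rewrite mxE // ltn_ord.
Qed.

Definition total_differential (w : 'I_n.+1 -> R) v : R := \sum_a v 0 a * w a.

Lemma total_differential_is_linear (w : 'I_n.+1 -> R) :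
  linear (total_differential w).
Proof.
move=> c u v; rewrite /total_differential scaler_sumr -big_split /=.
apply: eq_bigr => a _; rewrite !mxE mulrDl -mulrA; congr (_ + _).
Qed.

HB.instance Definition _ (w : 'I_n.+1 -> R) :=
  GRing.isLinear.Build R 'rV[R]_n.+1 R *:%R (total_differential w)
    (@total_differential_is_linear w).

Lemma C1_differentiable f x :
  (\forall y \near x, forall a, derivable f y (delta_mx 0 a)) ->
  (forall a, {for x, continuous (partial a f)}) ->
  differentiable f x.
Proof.
move=> fd fc; pose df := total_differential (fun a => partial a f x).
have dfc : continuous df.
  apply: (continuous_big add_continuous) => a _.
  have vac : continuous (fun v : 'rV[R]_n.+1 => v 0 a * partial a f x).
    by move=> v; apply: (@cvgM R _ (nbhs v));
      [exact: coord_continuous|exact: cvg_cst].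
  exact: vac.
apply: (differentiable_near dfc) => e e0.
(* Each of the [n.+1] coordinate steps contributes an error of at most [e'] times the norm of
   [h]. *)
pose e' := e / n.+1%:R; have e'0 : 0 < e' by rewrite divr_gt0.
have pc (a : 'I_n.+1) : \forall y \near x,
    `|partial a f x - partial a f y| <= e'.
  have fa : partial a f @ nbhs x --> partial a f x := fc a.
  by move/cvgrPdist_le : fa => /(_ _ e'0).
have /nbhs_ballP[d /= d0 dP] : nbhs x [set y |
    (forall a, derivable f y (delta_mx 0 a)) /\
    (forall a, `|partial a f x - partial a f y| <= e')].
  exact: filterI fd (filter_forall (nbhs_filter x) pc).
apply/nbhs_ballP; exists d => //= h.
rewrite -ball_normE /= sub0r normrN => hd.
have inb z : `|z - x| <= `|h| -> ball x d z.
  by move=> zh; rewrite -ball_normE /= distrC; exact: le_lt_trans hd.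
have [|z [zP E]] := @mean_value_partial f x (h + x).
  move=> z; rewrite addrK => /inb/dP[]; exact.
rewrite addrK in zP.
rewrite -[X in `|X|]/(f (h + x) - (f x + df h)) opprD addrA E.
rewrite /df /total_differential -sumrB.
apply: le_trans (ler_norm_sum _ _ _) _.
have -> : e * `|h| = \sum_(a < n.+1) e' * `|h|.
  by rewrite sumr_const card_ord -mulr_natl mulrA (mulrC _ e') divfK.
apply: ler_sum => a _; rewrite !mxE addrK -mulrBr normrM mulrC.
apply: ler_pM => //; last exact: normr_coord_le.
by rewrite distrC; have [_] := dP _ (inb _ (zP a)); exact.
Qed.

Lemma differentiable_deriveE f x v : differentiable f x ->
  'D_v f x = \sum_a v 0 a * partial a f x.
Proof.
move=> fd; rewrite deriveE // {1}[v]row_sum_delta linear_sum.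
by apply: eq_bigr => a _; rewrite linearZ /= /partial deriveE.
Qed.

(** [phi] is derivable in the direction [u] only, so it has no total differential to compose with.
    Restricted to the line through [p] along [u], it becomes a differentiable function of one real
    variable, to which the chain rule applies. *)
Lemma is_derive_chain (V : normedModType R) (phi : V -> 'rV[R]_n.+1) f
    (p u : V) dphi :
  differentiable f (phi p) -> is_derive p u phi dphi ->
  is_derive p u (f \o phi) (\sum_a dphi 0 a * partial a f (phi p)).
Proof.
move=> fd [/derivable1P pd dE].
have pd1 := (derivable1_diffP _ _).1 pd.
have pE : 0 *: u + p = p by rewrite scale0r add0r.
have fd' : differentiable f (phi (0 *: u + p)) by rewrite pE.
have cd := differentiable_comp pd1 fd'.
split; first exact/derivable1P/derivable1_diffP.
have D1 (W : normedModType R) (h : V -> W) :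
  'D_u h p = 'D_1 (fun s : R => h (s *: u + p)) 0.
  rewrite /derive; set g1 := fun s => s^-1 *: _; set g2 := fun s => s^-1 *: _.
  suff -> : g1 = g2 by [].
  by apply/funext => s; rewrite /g1 /g2 /= addr0 scale0r add0r [_%:A]mulr1.
pose line (s : R) := phi (s *: u + p).
have lineE : 'd line 0 1 = dphi by rewrite -deriveE // -D1.
rewrite D1 deriveE // -[LHS]/('d (f \o line) 0 1) diff_comp //= lineE.
by rewrite -deriveE // differentiable_deriveE // /line pE.
Qed.

(* On a small cube around [x], the mean value theorem along a path that changes
   one coordinate at a time gives max |f| <= max |f| / 2. *)
Lemma linear_ode_vanishing f (B : 'I_n.+1 -> 'rV[R]_n.+1 -> R) x :
  f x = 0 ->
  (forall a, {for x, continuous (B a)}) ->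
  (\forall y \near x, {for y, continuous f} /\
     forall a, is_derive y (delta_mx 0 a) f (B a y * f y)) ->
  \forall y \near x, f y = 0.
Proof.
move=> fx0 Bc fP.
(* The summand 1 makes the bound strict at [x] for all [a] at once, so that continuity at [x]
   extends it to a neighbourhood. *)
pose C := 1 + \sum_a `|B a x|.
have BC (a : 'I_n.+1) : `|B a x| < C.
  rewrite /C (bigD1 a) //= addrCA ltrDl.
  by rewrite ltr_pwDl // sumr_ge0.
have C0 : 0 < C by apply: le_lt_trans (BC ord0).
have Bn (a : 'I_n.+1) : \forall y \near x, `|B a y| < C.
  have Ba : B a @ nbhs x --> B a x := Bc a.
  exact: cvgr_lt (cvg_norm Ba) _ (BC a).
have /nbhs_ballP[d /= d0 dP] : nbhs x [set y | ({for y, continuous f} /\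
    forall a, is_derive y (delta_mx 0 a) f (B a y * f y)) /\
    forall a, `|B a y| < C].
  exact: filterI fP (filter_forall (nbhs_filter x) Bn).
(* Chosen so that [n.+1] increments of length at most [K], with slopes at most [C] times the maximum
   of [|f|], add up to half that maximum. In [r] below, [d / 2] keeps the closed cube inside the
   open ball. *)
pose K := (n.+1%:R * C)^-1 / 2.
have K0 : 0 < K by rewrite divr_gt0 // invr_gt0 mulr_gt0.
pose r := Num.min (d / 2) K.
have r0 : 0 < r by rewrite lt_min K0 divr_gt0.
have rd z : `|z - x| <= r -> ball x d z.
  rewrite le_min => /andP[zd _]; rewrite -ball_normE /= distrC.
  by apply: le_lt_trans zd _; rewrite ltr_pdivrMr // mulr_natr mulr2n ltrDl.
pose A := [set y : 'rV[R]_n.+1 | `|y - x| <= r].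
have cA : compact A.
  apply: bounded_closed_compact.
    exists (r + `|x|); split; first by rewrite num_real.
    move=> M Mr y /= yr; rewrite -[y](subrK x); apply: le_trans (ltW Mr).
    by apply: le_trans (ler_normD _ _) _; rewrite lerD2r.
  apply: (@closed_comp _ _ (fun y => `|y - x|) [set t | t <= r]); last first.
    exact: closed_le.
  move=> y _; have yx : (fun z => z - x) @ nbhs y --> y - x.
    by apply: cvgB; [exact: cvg_id|exact: cvg_cst].
  exact: cvg_norm yx.
have nfc : {within A, continuous (fun y => `|f y|)}.
  apply: continuous_in_subspaceT => y; rewrite inE => yA.
  have [[fy _] _] := dP y (rd _ yA).
  have fy' : f @ nbhs y --> f y := fy.
  exact: cvg_norm fy'.
have [|y yA ymax] := EVT_max_rV _ cA nfc.
  by exists x; rewrite /A /= subrr normr0 ltW.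
rewrite inE in yA.
have fy0 : f y = 0.
  have [|z [zP E]] := @mean_value_partial f x y.
    by move=> z zy a; have [[_ /(_ a) []]] := dP _ (rd _ (le_trans zy yA)).
  apply/eqP; rewrite -normr_le0; rewrite fx0 subr0 in E.
  have : `|f y| <= `|f y| / 2.
    rewrite {1}E; apply: le_trans (ler_norm_sum _ _ _) _.
    have -> : `|f y| / 2 = \sum_(a < n.+1) K * (C * `|f y|).
      rewrite sumr_const card_ord -mulr_natl /K; field.
      by rewrite lt0r_neq0 //= lt0r_neq0.
    apply: ler_sum => a _; rewrite normrM; apply: ler_pM => //.
      have := normr_coord_le (y - x) a; rewrite !mxE => /le_trans; apply.
      by apply: le_trans yA _; rewrite ge_min lexx orbT.
    have zA := le_trans (zP a) yA.
    have [[_ /(_ a)[_ Dz]] /(_ a) Bz] := dP _ (rd _ zA).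
    rewrite /partial Dz normrM; apply: ler_pM => //; first exact: ltW.
    by apply: ymax; rewrite inE.
  lra.
have fA z : A z -> f z = 0.
  move=> zA; apply/eqP; rewrite -normr_le0.
  by have := ymax z; rewrite fy0 normr0 inE; exact.
apply/nbhs_ballP; exists r => //= z; rewrite -ball_normE /= distrC => zr.
by apply: fA; rewrite /A /= ltW.
Qed.

End PartialDerivatives.

(** * Linear algebra of a hyperplane and its conormal *)

Section Hyperplane.
Context {K : fieldType} {k : nat}.
Implicit Types (e : 'M[K]_(k, k.+1)) (w z : 'rV[K]_k.+1) (G : 'M[K]_k.+1).

(** A dimension count: the rows of [e] span a [k]-dimensional subspace of the kernel of [w], and
    that kernel has dimension [k] as well. *)
Lemma sub_frame_of_normal e w z :
  row_free e -> w != 0 -> e *m w^T = 0 -> z *m w^T = 0 -> (z <= e)%MS.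
Proof.
move=> /eqP re w0 ew zw.
have eker : (e <= kermx w^T)%MS by apply/sub_kermxP.
have rker : \rank (kermx w^T) = k.
  by rewrite mxrank_ker mxrank_tr rank_rV w0 subn1.
have kere : (kermx w^T <= e)%MS.
  by rewrite -(geq_leqif (mxrank_leqif_sup eker)) re rker.
by apply: submx_trans kere; apply/sub_kermxP.
Qed.

Lemma normal_proportional e w z :
  row_free e -> w != 0 -> e *m w^T = 0 -> e *m z^T = 0 -> exists a, z = a *: w.
Proof.
move=> /eqP re w0 ew ez; apply/sub_rVP.
have tr0 u : e *m u^T = 0 -> u *m e^T = 0.
  by move=> eu; rewrite -[u]trmxK -trmx_mul eu trmx0.
have wker : (w <= kermx e^T)%MS by apply/sub_kermxP/tr0.
have rker : \rank (kermx e^T) = 1%N.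
  by rewrite mxrank_ker mxrank_tr re subSnn.
have kerw : (kermx e^T <= w)%MS.
  by rewrite -(geq_leqif (mxrank_leqif_sup wker)) rank_rV w0 rker.
by apply: submx_trans kerw; apply/sub_kermxP/tr0.
Qed.

(** Sylvester's rank inequality gives rank at least [k + k - (k + 1) = k - 1], which is positive
    exactly when [1 < k]. For [k = 1] a null direction makes the Gram matrix zero. *)
Lemma gram_neq0 e G :
  (1 < k)%N -> row_free e -> G \in unitmx -> e *m G *m e^T != 0.
Proof.
move=> k1 /eqP re uG; rewrite -mxrank_eq0 -lt0n.
have := mxrank_mul_min (e *m G) e^T.
rewrite mxrank_tr mxrankMfree ?row_free_unit // re.
by apply: leq_trans; rewrite subn_gt0 -addn1 ltn_add2l.
Qed.

(* [z] below is annihilated by [w], hence tangent, so that the umbilicity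
   hypothesis applies to it. *)
Lemma conormal_contraction e w G (t d l : 'rV[K]_k.+1) (F : K) :
  row_free e -> G \in unitmx -> e *m w^T = 0 -> w *m l^T != 0 ->
  (t <= e)%MS -> e *m d^T = F *: (e *m G *m t^T) ->
  (w *m invmx G *m d^T) 0 0 =
  (w *m invmx G *m w^T) 0 0 / (w *m l^T) 0 0 *
  ((l *m d^T) 0 0 - F * (l *m G *m t^T) 0 0).
Proof.
move=> re uG ew wl te umb.
have w0 : w != 0 by apply: contraNneq wl => ->; rewrite mul0mx.
set s := (w *m l^T) 0 0; set N := (w *m invmx G *m w^T) 0 0.
have s0 : s != 0.
  by apply: contraNneq wl => s0; rewrite [_ *m _]mx11_scalar -/s s0 raddf0.
have lw : l *m w^T = s%:M.
  by rewrite -[l]trmxK -trmx_mul [w *m _]mx11_scalar tr_scalar_mx.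
pose z := w *m invmx G - (N / s) *: l.
have /submxP[c zc] : (z <= e)%MS.
  apply: sub_frame_of_normal re w0 ew _.
  rewrite mulmxBl -scalemxAl lw [w *m _ *m _]mx11_scalar -/N.
  by rewrite scale_scalar_mx divfK // subrr.
have -> : w *m invmx G = c *m e + (N / s) *: l by rewrite -zc subrK.
have wt : w *m t^T = 0.
  have [b ->] := submxP te.
  by rewrite trmx_mul mulmxA -[w]trmxK -trmx_mul ew trmx0 mul0mx.
(* Lowering the index of [w *m invmx G] gives back [w], which annihilates the tangent vector [t].
   Only the multiple of [l] in [z] survives the pairing. *)
have cet : c *m (e *m G *m t^T) = - ((N / s) *: (l *m G *m t^T)).
  rewrite !mulmxA -zc !mulmxBl mulmxKV // wt sub0r.
  by rewrite -!scalemxAl.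
rewrite mulmxDl -mulmxA umb -scalemxAr cet -!scalemxAl !mxE.
by rewrite mulrBr mulrN addrC mulrCA.
Qed.

End Hyperplane.

(** * The propagation equation for the norm of the normal, in matrix form *)

Section ConormalNormPropagation.
Context {R : realType} {m : nat}.
(** Components along the hypersurface, as functions of its coordinates: the metric [G], the normal
    [w], the tangent frame [e]. [Gam a] is the connection contracted with the tangent vector [e_a],
    with the lower index on rows and the upper one on columns, so that [D a] is the covariant
    derivative of [w] along [e_a]. *)
Variables (G : 'rV[R]_m.+1 -> 'M[R]_m.+2) (w : 'rV[R]_m.+1 -> 'rV[R]_m.+2).
Variables (e : 'rV[R]_m.+1 -> 'M[R]_(m.+1, m.+2)) (F : 'rV[R]_m.+1 -> R).
Variables (Gam : 'I_m.+1 -> 'rV[R]_m.+1 -> 'M[R]_m.+2).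
Variables (dw : 'I_m.+1 -> 'rV[R]_m.+1 -> 'rV[R]_m.+2).

Let sqn (y : 'rV[R]_m.+1) : R := (w y *m invmx (G y) *m (w y)^T) 0 0.
Let D a y := dw a y - w y *m (Gam a y)^T.

(** The derivative prescribed for [G] is metric compatibility. Through it, the derivative of the
    inverse metric supplies two connection terms, one for each factor [w], which complete the two
    ordinary derivatives into covariant ones. Being 1 by 1 matrices, the two resulting terms are
    equal. *)
Lemma is_derive_conormal_norm a y :
  G y \in unitmx -> (G y)^T = G y ->
  is_derive y (delta_mx 0 a) G (Gam a y *m G y + (Gam a y *m G y)^T) ->
  is_derive y (delta_mx 0 a) w (dw a y) ->
  is_derive y (delta_mx 0 a) sqn (2 * (w y *m invmx (G y) *m (D a y)^T) 0 0).
Proof.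
move=> uG sG Gd wd.
have h := is_derive_mulmx (is_derive_mulmx wd (is_derive_invmx uG Gd))
  (is_derive_trmx wd).
have iG : (invmx (G y))^T = invmx (G y) by rewrite trmx_inv sG.
have E : invmx (G y) *m (Gam a y *m G y + (Gam a y *m G y)^T) *m invmx (G y) =
    invmx (G y) *m Gam a y + (invmx (G y) *m Gam a y)^T.
  rewrite mulmxDr mulmxDl !mulmxA mulmxK // trmx_mul sG !mulmxA mulVmx //.
  by rewrite mul1mx trmx_mul iG.
pose X := w y *m invmx (G y) *m (dw a y)^T.
pose Y := w y *m invmx (G y) *m Gam a y *m (w y)^T.
apply: is_derive_cvg.
have /cvg_mxP/(_ 0 0) := cvg_is_derive h.
rewrite E; set L := (X in _ --> X 0 0 -> _) => hL.
have -> : 2 * (w y *m invmx (G y) *m (D a y)^T) 0 0 = L 0 0.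
  have -> : w y *m invmx (G y) *m (D a y)^T = X - Y.
    by rewrite /D linearB /= mulmxBr trmx_mul trmxK mulmxA.
  have -> : L = X^T - (Y + Y^T) + X.
    rewrite /L mulmxDl mulmxN mulNmx mulmxDr mulmxDl !mulmxA /X /Y.
    by rewrite !trmx_mul !trmxK iG !mulmxA.
  by rewrite !mxE; ring.
apply: cvg_trans hL; apply: near_eq_cvg; near=> t.
by rewrite /sqn !mxE.
Unshelve. all: by end_near. Qed.

Variable x : 'rV[R]_m.+1.
Hypothesis metric_near : \forall y \near x, [/\ G y \in unitmx, (G y)^T = G y,
  {for y, continuous G} &
  forall a, is_derive y (delta_mx 0 a) G (Gam a y *m G y + (Gam a y *m G y)^T)].
Hypothesis normal_near : \forall y \near x, [/\ w y != 0, e y *m (w y)^T = 0,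
  {for y, continuous w} & forall a, is_derive y (delta_mx 0 a) w (dw a y)].
Hypothesis frame_near : \forall y \near x, row_free (e y).
Hypothesis umbilical_near : \forall y \near x, forall a,
  e y *m (D a y)^T = F y *: (e y *m G y *m (row a (e y))^T).
Hypothesis e_cts : {for x, continuous e}.
Hypothesis Gam_cts : forall a, {for x, continuous (Gam a)}.
Hypothesis dw_cts : forall a, {for x, continuous (dw a)}.

Let GC : G @ nbhs x --> G x.
Proof. by have [] := nbhs_singleton metric_near. Qed.

Let wC : w @ nbhs x --> w x.
Proof. by have [] := nbhs_singleton normal_near. Qed.

Let DC a : D a @ nbhs x --> D a x.
Proof.
apply: cvgB; first exact: dw_cts.
by apply: cvg_mulmx; [exact: wC|apply: cvg_trmx; exact: Gam_cts].
Qed.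

Lemma umbilical_factor_cts : (0 < m)%N -> {for x, continuous F}.
Proof.
move=> m0; have [uG _ _ _] := nbhs_singleton metric_near.
have /matrix0Pn[b [a hba]] :=
  @gram_neq0 _ _ (e x) (G x) m0 (nbhs_singleton frame_near) uG.
pose h y := (e y *m G y *m (e y)^T) b a.
have hC : h @ nbhs x --> h x.
  apply: cvg_mx_coord; apply: cvg_mulmx; last exact: cvg_trmx e_cts.
  by apply: cvg_mulmx; [exact: e_cts|exact: GC].
have KC : (fun y => (e y *m (D a y)^T) b 0) @ nbhs x --> (e x *m (D a x)^T) b 0.
  apply: cvg_mx_coord; apply: cvg_mulmx; first exact: e_cts.
  exact: cvg_trmx (@DC a).
have hE y : (e y *m G y *m (row a (e y))^T) b 0 = h y.
  by rewrite /h !mxE; apply: eq_bigr => i _; rewrite !mxE.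
have FE : \forall y \near x, (e y *m (D a y)^T) b 0 / h y = F y.
  near=> y.
  have hy : h y != 0 by near: y; exact: cvgr_neq0 hC hba.
  have -> : e y *m (D a y)^T = F y *: (e y *m G y *m (row a (e y))^T).
    by near: y; apply: filterS umbilical_near => y; exact.
  by rewrite mxE hE mulfK.
suff : F @ nbhs x --> F x by [].
have : (fun y => (e y *m (D a y)^T) b 0 / h y) @ nbhs x --> F x.
  by rewrite -(nbhs_singleton FE); apply: cvgM => //; exact: cvgV.
by apply: cvg_trans; apply: near_eq_cvg.
Unshelve. all: by end_near. Qed.

(** Continuity of [F] is a separate premise because it has two sources: the preceding lemma when
    [0 < m], and the definition of [umbilical] for curves. *)
Lemma conormal_norm_vanishes_near :
  {for x, continuous F} -> sqn x = 0 -> \forall y \near x, sqn y = 0.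
Proof.
move=> FC sx0.
(* The components of the normal at [x] are those of a vector which stays
   transversal near [x]. *)
pose l := w x.
pose B a y := 2 * (((w y *m l^T) 0 0)^-1 *
  ((l *m (D a y)^T) 0 0 - F y * (l *m G y *m (row a (e y))^T) 0 0)).
have [w0 _ _ _] := nbhs_singleton normal_near.
(* With this [l], the pairing at [x] is the sum of the squares of the components of [w x], which is
   positive whatever the causal character. *)
have l0 : (w x *m l^T) 0 0 != 0.
  rewrite mxE; under eq_bigr do rewrite mxE -expr2.
  apply: contraNneq w0 => /eqP.
  rewrite psumr_eq0 => [|i _]; last exact: sqr_ge0.
  move=> /allP w2; apply/eqP/rowP => i; rewrite mxE.
  by have := w2 i (mem_index_enum i); rewrite /= sqrf_eq0 => /eqP.
have cl : (fun=> l) @ nbhs x --> l by exact: cvg_cst.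
have slC : (fun y => (w y *m l^T) 0 0) @ nbhs x --> (w x *m l^T) 0 0.
  by apply: cvg_mx_coord; apply: cvg_mulmx; [exact: wC|exact: cvg_cst].
apply: (@linear_ode_vanishing _ _ sqn B x sx0) => [a|].
  have lD : (fun y => (l *m (D a y)^T) 0 0) @ nbhs x --> (l *m (D a x)^T) 0 0.
    by apply: cvg_mx_coord; apply: cvg_mulmx cl (cvg_trmx (@DC a)).
  have rC : (fun y => row a (e y)) @ nbhs x --> row a (e x).
    apply/cvg_mxP => i j; under eq_fun do rewrite mxE; rewrite mxE.
    exact: cvg_mx_coord e_cts.
  have lG : (fun y => (l *m G y *m (row a (e y))^T) 0 0) @ nbhs x -->
      (l *m G x *m (row a (e x))^T) 0 0.
    apply: cvg_mx_coord; apply: cvg_mulmx (cvg_trmx rC).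
    exact: cvg_mulmx cl GC.
  have FC' : F @ nbhs x --> F x := FC.
  have : B a @ nbhs x --> B a x.
    apply: cvgM; first exact: cvg_cst.
    apply: cvgM; first exact: cvgV.
    by apply: cvgB => //; exact: cvgM.
  by [].
near=> y.
have [uG sG GCy Gd] : [/\ G y \in unitmx, (G y)^T = G y,
  {for y, continuous G} & forall a,
  is_derive y (delta_mx 0 a) G (Gam a y *m G y + (Gam a y *m G y)^T)].
  by near: y.
have [_ ew wCy wd] : [/\ w y != 0, e y *m (w y)^T = 0,
  {for y, continuous w} & forall a, is_derive y (delta_mx 0 a) w (dw a y)].
  by near: y.
have ef : row_free (e y) by near: y.
have umb : forall a,
  e y *m (D a y)^T = F y *: (e y *m G y *m (row a (e y))^T) by near: y.
have ly : (w y *m l^T) 0 0 != 0 by near: y; exact: cvgr_neq0 slC l0.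
split=> [|a].
  have GCy' : G @ nbhs y --> G y := GCy.
  have wCy' : w @ nbhs y --> w y := wCy.
  have : sqn @ nbhs y --> sqn y.
    apply: cvg_mx_coord; apply: cvg_mulmx (cvg_trmx wCy').
    exact: cvg_mulmx wCy' (cvg_invmx uG GCy').
  by [].
have -> : B a y * sqn y = 2 * (w y *m invmx (G y) *m (D a y)^T) 0 0.
  have wl : w y *m l^T != 0 by apply: contraNneq ly => ->; rewrite mxE.
  rewrite (conormal_contraction ef uG ew wl (row_sub a (e y)) (umb a)).
  by rewrite /B /sqn; ring.
exact: is_derive_conormal_norm.
Unshelve. all: by end_near. Qed.

End ConormalNormPropagation.

(** * From componentwise regularity to differentiability *)

Section CkFunctions.
Context {R : realType}.

Lemma is_derive_mx (V : normedModType R) m n (f : V -> 'M[R]_(m, n)) x v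
    (df : 'M[R]_(m, n)) :
  (forall i j, is_derive x v (fun y => f y i j) (df i j)) -> is_derive x v f df.
Proof.
move=> fd; apply: is_derive_cvg; apply/cvg_mxP => i j.
under eq_fun do rewrite !mxE.
exact: cvg_is_derive.
Qed.

Lemma Ck_derivable n k (A : set 'rV[R]_n.+1) f x a :
  Ck k.+1 A f -> A x -> derivable f x (delta_mx 0 a).
Proof. by case=> _ /(_ a)[fd _] Ax; exact: fd. Qed.

Lemma Ck_partial n k (A : set 'rV[R]_n.+1) f a :
  Ck k.+1 A f -> Ck k A (partial a f).
Proof. by case=> _ /(_ a)[]. Qed.

Lemma Ck_cts n k (A : set 'rV[R]_n.+1) f x :
  Ck k A f -> A x -> f @ nbhs x --> f x.
Proof. by case: k => [|k] [fc _] Ax; exact: fc. Qed.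

Lemma Ck_differentiable n k (A : set 'rV[R]_n.+1) f x :
  open A -> Ck k.+1 A f -> A x -> differentiable f x.
Proof.
move=> oA fA Ax; apply: C1_differentiable => [|a].
  near=> y; move=> a; apply: Ck_derivable fA _.
  by near: y; exact: open_nbhs_nbhs.
exact: Ck_cts (Ck_partial a fA) Ax.
Unshelve. all: by end_near. Qed.

End CkFunctions.

(** * Nondegenerate metrics, the Levi-Civita connection, and chart images *)

Section LorentzGeometry.
Context {R : realType}.

Lemma lorentzian_unitmx n (A : 'M[R]_n.+1) : lorentzian A -> A \in unitmx.
Proof.
move=> [_ [P uP PA]].
have : (Defs.minkowski n : 'M[R]_n.+1) \in unitmx.
  rewrite unitmxE unitfE det_diag; apply/prodf_neq0 => i _.
  by rewrite mxE; case: ifP => _; rewrite ?oppr_eq0 oner_eq0.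
by rewrite -PA !unitmx_mul => /andP[/andP[]].
Qed.

(* [dg s a b] stands for the derivative of g_ab along x^s, so that the
   conclusion is nabla g = 0. *)
Lemma levi_civita_compatible n (A : 'M[R]_n) (dg : 'I_n -> 'I_n -> 'I_n -> R) :
  A \in unitmx -> A^T = A -> (forall s a b, dg s a b = dg s b a) ->
  let Gam r mu nu := 2^-1 *
    \sum_(s < n) invmx A r s * (dg mu s nu + dg nu s mu - dg s mu nu) in
  forall mu nu sg, dg mu nu sg =
    \sum_r Gam r mu nu * A r sg + \sum_r Gam r mu sg * A r nu.
Proof.
move=> uA sA dgC Gam mu nu sg.
(* Lowering the upper index cancels the inverse metric and leaves the Christoffel symbols of the
   first kind. In the sum of the two that occur, symmetry cancels every derivative but the wanted
   one. *)
have lower a b : \sum_r Gam r mu a * A r b =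
    2^-1 * (dg mu b a + dg a b mu - dg b mu a).
  pose v := \col_s (dg mu s a + dg a s mu - dg s mu a).
  have -> : dg mu b a + dg a b mu - dg b mu a = (A *m (invmx A *m v)) b 0.
    by rewrite mulmxA mulmxV // mul1mx mxE.
  rewrite [in RHS]mxE mulr_sumr; apply: eq_bigr => r _.
  have -> : (invmx A *m v) r 0 =
      \sum_(s < n) invmx A r s * (dg mu s a + dg a s mu - dg s mu a).
    by rewrite mxE; apply: eq_bigr => s _; rewrite mxE.
  by rewrite -{2}sA mxE /Gam; ring.
rewrite !lower (dgC mu sg nu) (dgC nu sg mu) (dgC sg nu mu); lra.
Qed.

(** Inside the open image of the whole chart, membership in the image of [W] is the condition that
    [pt c] lands in [W], which is open by continuity of [pt c]. *)
Lemma open_chart_image (T : topologicalType) n (c : chart (R := R) T n) W :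
  open W -> open (Defs.coord c @` (dom c `&` W)).
Proof.
move=> oW; rewrite openE => _ [q [cq Wq] <-]; rewrite /interior.
have cx : (Defs.coord c @` dom c) (Defs.coord c q) by exists q.
have ptc : pt c @ nbhs (Defs.coord c q) --> pt c (Defs.coord c q).
  exact: pt_cts.
have img : nbhs (Defs.coord c q) (Defs.coord c @` dom c).
  by apply: open_nbhs_nbhs; split=> //; exact: img_open.
have ptW : nbhs (Defs.coord c q) (pt c @^-1` W).
  by apply: ptc; rewrite coordK //; exact: open_nbhs_nbhs.
near=> y.
have [p cp pE] : (Defs.coord c @` dom c) y by near: y.
exists p => //; split=> //; rewrite -(coordK cp) pE.
by near: y.
Unshelve. all: by end_near. Qed.

End LorentzGeometry.

Section LocalPropagation.
Context {R : realType} {m : nat} {V S : topologicalType}.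
Context {M : manifold (R := R) 3 V m.+1} {g : lorentz_metric (k := 2) M}.
Context {H : hypersurface M S}.

(** The tensor laws of the metric and of the normal form make the norm independent of the spacetime
    chart. Any other normal at the point is proportional to the given one, since the annihilator of
    the tangent space is a line, and this produces the square. *)
Lemma conormal_norm_chart (d d' : chart S m) c c' q (U : set S) n w :
  normal_form H U n -> U q -> charts_at H d c q -> charts_at H d' c' q ->
  normal_covector H d' c' q w ->
  exists2 a, a != 0 &
    conormal_norm g H c' q w = a ^+ 2 * conormal_norm g H c q (n c q).
Proof.
move=> [nN nT _] Uq dcq dcq' [w0 ew].
have [n0 en] := nN _ _ _ Uq dcq'.
have [_ Mc _ cq] := dcq; have [Hd' Mc' dq' cq'] := dcq'.
have [a wE] := normal_proportional (emb_rank Hd' Mc' dq' cq') n0 en ew.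
exists a; first by apply: contraNneq w0 => a0; rewrite wE a0 scale0r.
rewrite wE /conormal_norm (nT c c' q Uq Mc Mc' cq cq').
have uG := lorentzian_unitmx (metric_lorentzian g Mc cq).
have uG' := lorentzian_unitmx (metric_lorentzian g Mc' cq').
move: uG; rewrite (metric_change g Mc Mc' cq cq').
set T := trans _ _ _; set G' := metric g c' _ => uG.
(* Invertibility of the coordinate Jacobian is read off the nondegeneracy of the metric that it
   transforms. *)
have uT : T \in unitmx by move: uG; rewrite !unitmx_mul => /andP[/andP[]].
have TinvT : T^T *m invmx (T *m G' *m T^T) *m T = invmx G'.
  apply: (can_inj (mulKmx uG')); apply: (can_inj (mulKmx uT)).
  by rewrite mulmxV // mulmx1 !mulmxA mulmxV // mul1mx.
rewrite trmx_mul trmxK !mulmxA -(mulmxA (n c' q)) -(mulmxA (n c' q)) TinvT.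
by rewrite linearZ /= -scalemxAr -!scalemxAl !mxE; ring.
Qed.

End LocalPropagation.

(** * Metric, frame and connection pulled back to the coordinates of the hypersurface *)

Section CoordinateExpressions.
Context {R : realType} {m : nat} {V S : topologicalType}.
Context {M : manifold (R := R) 3 V m.+1} {g : lorentz_metric (k := 2) M}.
Context {H : hypersurface M S} {d : chart (R := R) S m}.
Context {c : chart (R := R) V m.+1}.
Hypotheses (Hd : atlas (hyp_manifold H) d) (Mc : atlas M c).

Let rep := local_rep (emb H) d c.
Let A := Defs.coord d @` (dom d `&` emb H @^-1` dom c).
Let G y := metric g c (emb H (pt d y)).
Let comp i j z := metric g c (pt c z) i j.

Let openA : open A.
Proof.
apply: open_chart_image; apply: open_comp (@dom_open _ _ _ c) => q _.
exact: emb_cts.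
Qed.

Let nearA y : A y -> nbhs y A.
Proof. by move=> Ay; exact: open_nbhs_nbhs. Qed.

Let ptA y : A y ->
  [/\ dom d (pt d y), dom c (emb H (pt d y)) & Defs.coord d (pt d y) = y].
Proof. by move=> [q [dq cq] <-]; rewrite coordK. Qed.

Lemma local_rep_cts y : A y -> rep @ nbhs y --> rep y.
Proof.
move=> Ay; apply/cvg_mxP => i j; rewrite (ord1 i).
exact: Ck_cts (emb_Ck Hd Mc j) Ay.
Qed.

Lemma is_derive_local_rep a y :
  A y -> is_derive y (delta_mx 0 a) rep (row a (jac rep y)).
Proof.
move=> Ay; apply: is_derive_mx => i j; rewrite (ord1 i) !mxE.
by apply: derivableP; exact: Ck_derivable (emb_Ck Hd Mc j) Ay.
Qed.

Lemma jac_local_rep_cts y : A y -> jac rep @ nbhs y --> jac rep y.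
Proof.
move=> Ay; apply/cvg_mxP => a j; under eq_fun do rewrite mxE; rewrite mxE.
exact: Ck_cts (Ck_partial a (emb_Ck Hd Mc j)) Ay.
Qed.

Let B := Defs.coord c @` dom c.

Let repB y : A y -> B (rep y).
Proof. by move=> /ptA[_ cq _]; exists (emb H (pt d y)). Qed.

Let GE y i j : A y -> G y i j = comp i j (rep y).
Proof. by move=> /ptA[_ cq _]; rewrite /comp /rep /local_rep /= coordK. Qed.

Lemma metric_along_cts y : A y -> G @ nbhs y --> G y.
Proof.
move=> Ay; apply/cvg_mxP => i j; rewrite GE //.
have cC : comp i j @ nbhs (rep y) --> comp i j (rep y).
  exact: Ck_cts (metric_Ck g i j Mc) (repB Ay).
have : comp i j \o rep @ nbhs y --> comp i j (rep y).
  exact: cvg_comp (local_rep_cts Ay) cC.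
apply: cvg_trans; apply: near_eq_cvg.
by apply: filterS (nearA Ay) => z Az; rewrite GE.
Qed.

Definition frame_connection a y : 'M[R]_m.+2 :=
  \matrix_(nu, rho) \sum_(mu < m.+2)
    christoffel g c (emb H (pt d y)) rho mu nu * jac rep y a mu.

Lemma metric_along_unitmx y : A y -> G y \in unitmx.
Proof.
move=> /ptA[_ cq _]; exact: lorentzian_unitmx (metric_lorentzian g Mc cq).
Qed.

Lemma metric_along_sym y : A y -> (G y)^T = G y.
Proof. by move=> /ptA[_ cq _]; have [] := metric_lorentzian g Mc cq. Qed.

(** By the chain rule the derivative is [e_a^mu d_mu g]. The vanishing of [nabla g] rewrites each
    [d_mu g] as two Christoffel terms, and contraction with [e_a] turns these into the pulled-back
    connection. *)
Lemma is_derive_metric_along a y : A y ->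
  is_derive y (delta_mx 0 a) G
    (frame_connection a y *m G y + (frame_connection a y *m G y)^T).
Proof.
move=> Ay; apply: is_derive_mx => nu sg.
have near_rep : \near y, (comp nu sg \o rep) y = G y nu sg.
  by apply: filterS (nearA Ay) => z Az; rewrite GE.
apply: near_eq_is_derive near_rep _.
have oB : open B by exact: img_open.
have cd : differentiable (comp nu sg) (rep y).
  exact: Ck_differentiable oB (metric_Ck g nu sg Mc) (repB Ay).
have := is_derive_chain cd (is_derive_local_rep a Ay).
set l := (X in is_derive _ _ _ X -> _) => h.
suff <- : l = (frame_connection a y *m G y +
    (frame_connection a y *m G y)^T) nu sg.
  by [].
(* These derivatives run in all spacetime directions, so the symmetry of the metric is used on a
   full neighbourhood of the image point and not only along the hypersurface. *)
have compC s i j : partial s (comp i j) (rep y) = partial s (comp j i) (rep y).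
  apply: near_eq_derive; near=> z.
  have [p cp <-] : B z.
    by near: z; apply: open_nbhs_nbhs; split=> //; exact: repB.
  rewrite /comp coordK //; have [sG _] := metric_lorentzian g Mc cp.
  by rewrite -{1}sG mxE.
have LC := levi_civita_compatible (metric_along_unitmx Ay)
  (metric_along_sym Ay) compC.
clear h; rewrite /l !mxE.
under eq_bigr => mu _ do rewrite mxE LC mulrDr.
rewrite big_split /=; congr (_ + _).
- under [RHS]eq_bigr => r _ do rewrite mxE mulr_suml.
  rewrite exchange_big /=; apply: eq_bigr => mu _; rewrite mulr_sumr.
  by apply: eq_bigr => r _; rewrite mulrA [X in X * _]mulrC.
- under [RHS]eq_bigr => r _ do rewrite mxE mulr_suml.
  rewrite exchange_big /=; apply: eq_bigr => mu _; rewrite mulr_sumr.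
  by apply: eq_bigr => r _; rewrite mulrA [X in X * _]mulrC.
Unshelve. all: by end_near. Qed.

Lemma frame_connection_cts a y : A y ->
  frame_connection a @ nbhs y --> frame_connection a y.
Proof.
move=> Ay; apply/cvg_mxP => nu rho.
under eq_fun do rewrite mxE; rewrite mxE.
have dC s i j : (fun z => partial s (comp i j) (rep z)) @ nbhs y -->
    partial s (comp i j) (rep y).
  apply: cvg_comp (local_rep_cts Ay) _.
  exact: Ck_cts (Ck_partial s (metric_Ck g i j Mc)) (repB Ay).
have iC : (fun z => invmx (G z)) @ nbhs y --> invmx (G y).
  by apply: cvg_invmx; [exact: metric_along_unitmx|exact: metric_along_cts].
apply: (cvg_big add_continuous) => mu _; apply: cvgM.
  apply: cvgM; first exact: cvg_cst.
  apply: (cvg_big add_continuous) => s _; apply: cvgM.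
    exact: cvg_mx_coord iC.
  by apply: cvgB; [apply: cvgD|]; exact: dC.
exact: cvg_mx_coord (jac_local_rep_cts Ay).
Qed.

End CoordinateExpressions.

(** * The norm of the normal near one point of the hypersurface *)

Section ConstantSignature.
Context {R : realType} {m : nat} {V S : topologicalType}.
Context {M : manifold (R := R) 3 V m.+1} {g : lorentz_metric (k := 2) M}.
Context {H : hypersurface M S}.

(** The derivative direction is the first index of the second form, so for fixed [a] the frame
    contraction runs over the second index and yields a column. This is the left side of the
    umbilicity hypothesis of the matrix argument. *)
Lemma second_form_conormal (n : chart (R := R) V m.+1 -> S -> 'rV[R]_m.+2)
    (d : chart (R := R) S m) (c : chart (R := R) V m.+1) q (a : 'I_m.+1) :
  dom d q ->
  let y := Defs.coord d q in
  let dn := \row_nu partial a (fun xi => n c (pt d xi) 0 nu) y in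
  let Gam := frame_connection (g := g) (H := H) (d := d) (c := c) a y in
  let Dn := dn - n c q *m Gam^T in
  tangent_frame H d c q *m Dn^T = \col_b second_form g H n d c q a b.
Proof.
move=> dq y dn Gam Dn; apply/colP => b; rewrite !mxE; apply: eq_bigr => nu _.
congr (_ * _); rewrite !mxE; congr (_ - _).
rewrite exchange_big /=; apply: eq_bigr => rho _; rewrite !mxE mulr_sumr.
apply: eq_bigr => mu _; rewrite coordK // mulrC; congr (_ * _).
Qed.

Variables (d : chart (R := R) S m) (c : chart (R := R) V m.+1) (q0 : S).
Variables (U : set S) (n : chart (R := R) V m.+1 -> S -> 'rV[R]_m.+2).
Variable F : S -> R.
Hypotheses (openU : open U) (Uq0 : U q0) (nU : normal_form H U n).
Hypothesis dcq0 : charts_at H d c q0.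
Hypothesis umb : forall d c q, U q -> charts_at H d c q ->
  second_form g H n d c q = F q *: first_form g H d c q.
Hypothesis F_cts : m = 0%N -> forall q, U q -> {for q, continuous F}.

(** [nu] lives on the hypersurface, where connectedness is used; [nu'] below is its expression on
    the coordinate domain, where derivatives are taken. *)
Let nu q := conormal_norm g H c q (n c q).
Let x0 := Defs.coord d q0.
Let w xi := n c (pt d xi).
Let G xi := metric g c (emb H (pt d xi)).
Let nu' xi := (w xi *m invmx (G xi) *m (w xi)^T) 0 0.

Let AU := Defs.coord d @` (dom d `&` emb H @^-1` dom c `&` U).

Let openAU : open AU.
Proof.
rewrite /AU -setIA; apply: open_chart_image; apply: openI => //.
by apply: open_comp (@dom_open _ _ _ c) => q _; exact: emb_cts.
Qed.

Let AU_A y : AU y -> (Defs.coord d @` (dom d `&` emb H @^-1` dom c)) y.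
Proof. by move=> [q [dcq _] <-]; exists q. Qed.

Let AUP y : AU y ->
  [/\ Defs.coord d (pt d y) = y, U (pt d y) & charts_at H d c (pt d y)].
Proof.
have [Hd Mc _ _] := dcq0.
by move=> [q [[dq cq] Uq] <-]; rewrite coordK.
Qed.

Let AUx0 : AU x0.
Proof. by have [_ _ dq cq] := dcq0; exists q0. Qed.

Let nearAU : \near x0, AU x0.
Proof. exact: open_nbhs_nbhs. Qed.

Let w_cts y : AU y -> w @ nbhs y --> w y.
Proof.
move=> Ay; apply/cvg_mxP => i j; rewrite (ord1 i).
have [Hd Mc _ _] := dcq0; have [_ _ /(_ _ _ Hd Mc j) wC] := nU.
exact: Ck_cts wC Ay.
Qed.

Let nu'_cts : nu' @ nbhs x0 --> nu' x0.
Proof.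
have [Hd Mc _ _] := dcq0.
have uG := metric_along_unitmx (g := g) Mc (AU_A AUx0).
have GC := metric_along_cts (g := g) Hd Mc (AU_A AUx0).
apply: cvg_mx_coord; apply: cvg_mulmx (cvg_trmx (w_cts AUx0)).
exact: cvg_mulmx (w_cts AUx0) (cvg_invmx uG GC).
Qed.

Let nu'_vanishes : nu' x0 = 0 -> \near x0, nu' x0 = 0.
Proof.
have [Hd Mc dq0 cq0] := dcq0.
pose e := jac (local_rep (emb H) d c).
pose Gam := frame_connection (g := g) (H := H) (d := d) (c := c).
pose dw a xi := \row_j partial a (fun xi => w xi 0 j) xi.
have wCk j : Ck 2 AU (fun xi => w xi 0 j).
  by have [_ _ /(_ _ _ Hd Mc j)] := nU.
have metric_near : \near x0, [/\ G x0 \in unitmx, (G x0)^T = G x0,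
  {for x0, continuous G} &
  forall a, is_derive x0 (delta_mx 0 a) G
    (Gam a x0 *m G x0 + (Gam a x0 *m G x0)^T)].
  apply: filterS nearAU => y /AU_A Ay; split.
  - exact: metric_along_unitmx.
  - exact: metric_along_sym.
  - exact: metric_along_cts.
  - by move=> a; exact: is_derive_metric_along.
have normal_near : \near x0, [/\ w x0 != 0, e x0 *m (w x0)^T = 0,
  {for x0, continuous w} & forall a, is_derive x0 (delta_mx 0 a) w (dw a x0)].
  apply: filterS nearAU => y Ay; have [yE Uy dcy] := AUP Ay.
  have [nN _ _] := nU; have [n0 en] := nN _ _ _ Uy dcy.
  split=> //; first by move: en; rewrite /tangent_frame yE.
    exact: w_cts.
  move=> a; apply: is_derive_mx => i j; rewrite (ord1 i) mxE.
  by apply: derivableP; exact: Ck_derivable (wCk j) Ay.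
have frame_near : \near x0, row_free (e x0).
  apply: filterS nearAU => y Ay; have [yE Uy [_ _ dy cy]] := AUP Ay.
  by have := emb_rank (h := H) _ Mc dy cy; rewrite yE; exact.
have umb_near : \near x0, forall a,
    e x0 *m (dw a x0 - w x0 *m (Gam a x0)^T)^T =
    F (pt d x0) *: (e x0 *m G x0 *m (row a (e x0))^T).
  apply: filterS nearAU => y Ay a; have [yE Uy dcy] := AUP Ay.
  have [_ _ dy cy] := dcy.
  have := second_form_conormal n c a dy; rewrite /tangent_frame yE => ->.
  apply/colP => b; rewrite mxE (umb Uy dcy) mxE [RHS]mxE; congr (_ * _).
  rewrite /first_form /tangent_frame yE -/(e y) -/(G y).
  (* Umbilicity delivers the entry [a b] of [h], while the column indexed by [b] carries the entry
     [b a]; the symmetry of the metric reconciles them. *)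
  have -> : (e y *m G y *m (e y)^T) a b = (e y *m G y *m (e y)^T) b a.
    have sG : (G y)^T = G y by exact: metric_along_sym (AU_A Ay).
    by rewrite -[in LHS]sG -[e y in LHS]trmxK -!trmx_mul mulmxA mxE trmxK.
  by rewrite !mxE; apply: eq_bigr => i _; rewrite !mxE.
have e_cts : {for x0, continuous e} by exact: jac_local_rep_cts (AU_A AUx0).
have Gam_cts a : {for x0, continuous (Gam a)}.
  exact: frame_connection_cts (AU_A AUx0).
have dw_cts a : {for x0, continuous (dw a)}.
  suff : dw a @ nbhs x0 --> dw a x0 by [].
  apply/cvg_mxP => i j; under eq_fun do rewrite mxE; rewrite mxE.
  exact: Ck_cts (Ck_partial a (wCk j)) AUx0.
apply: (conormal_norm_vanishes_near metric_near normal_near frame_near umb_near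
  e_cts Gam_cts dw_cts).
(* In dimension at least 2 continuity of [F] follows from the quotient of the two forms. On a curve
   it is the extra clause of [umbilical], carried to coordinates by the continuity of [pt d]. *)
have [m0|m0] := posnP m; last exact: umbilical_factor_cts metric_near
  normal_near frame_near umb_near e_cts Gam_cts dw_cts m0.
have ptC : pt d @ nbhs x0 --> pt d x0 by apply: pt_cts; exists q0.
have FC : F @ nbhs (pt d x0) --> F (pt d x0).
  by rewrite coordK //; exact: F_cts.
suff : (fun y => F (pt d y)) @ nbhs x0 --> F (pt d x0) by [].
exact: cvg_comp ptC FC.
Qed.

Let coord_q0 : Defs.coord d @ nbhs q0 --> x0.
Proof. by have [_ _ dq _] := dcq0; exact: coord_cts. Qed.

Let near_nuE : \forall q \near q0, nu' (Defs.coord d q) = nu q.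
Proof.
have [_ _ dq0 _] := dcq0.
apply: filterS (open_nbhs_nbhs (conj (@dom_open _ _ _ d) dq0)) => q dq.
by rewrite /nu' /w /G coordK.
Qed.

Lemma conormal_norm_along_cts : nu @ nbhs q0 --> nu q0.
Proof.
rewrite -(nbhs_singleton near_nuE).
have : nu' \o Defs.coord d @ nbhs q0 --> nu' x0.
  exact: cvg_comp coord_q0 nu'_cts.
by apply: cvg_trans; exact: near_eq_cvg.
Qed.

Lemma conormal_norm_along_vanishes : nu q0 = 0 -> \forall q \near q0, nu q = 0.
Proof.
rewrite -{1}(nbhs_singleton near_nuE) => /nu'_vanishes/coord_q0 nu0.
by apply: filterS2 near_nuE nu0 => q <-.
Qed.

End ConstantSignature.

(** * Connectedness and the global conclusion *)

Section ConnectedTrichotomy.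
Context {T : topologicalType}.

(** The complement of each of the three open sets is the union of the other two, so each is both
    open and closed, and a nonempty one is the whole space. *)
Lemma connected_trichotomy (P0 P1 P2 : T -> Prop) :
  connected [set: T] ->
  (forall q, P0 q -> \forall q' \near q, P0 q') ->
  (forall q, P1 q -> \forall q' \near q, P1 q') ->
  (forall q, P2 q -> \forall q' \near q, P2 q') ->
  (forall q, [\/ P0 q, P1 q | P2 q]) ->
  (forall q, ~ (P0 q /\ P1 q) /\ ~ (P0 q /\ P2 q) /\ ~ (P1 q /\ P2 q)) ->
  [\/ forall q, P0 q, forall q, P1 q | forall q, P2 q].
Proof.
move=> cT o0 o1 o2 cov dis.
have clopen (P Q : T -> Prop) : (forall q, P q -> \forall q' \near q, P q') ->
    (forall q, Q q -> \forall q' \near q, Q q') -> (forall q, ~ P q <-> Q q) ->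
    (exists q, P q) -> forall q, P q.
  move=> oP oQ PQ exP q.
  suff -> : P = [set: T] by [].
  apply: cT => //.
    exists P; first by rewrite openE.
    by rewrite setTI.
  exists P; last by rewrite setTI.
  rewrite -openC openE => q' /PQ/oQ; apply: filterS => z /PQ; exact.
have [ex0|no0] := pselect (exists q, P0 q).
  apply: Or31; apply: (clopen P0 (fun q => P1 q \/ P2 q)) => // q.
    by case=> [/o1|/o2]; apply: filterS => z; [left|right].
  by have := dis q; case: (cov q); tauto.
have [ex1|no1] := pselect (exists q, P1 q).
  apply: Or32; apply: (clopen P1 (fun q => P0 q \/ P2 q)) => // q.
    by case=> [/o0|/o2]; apply: filterS => z; [left|right].
  by have := dis q; case: (cov q); tauto.
(* This last case also takes care of an empty space. *)
apply: Or33 => q; case: (cov q) => // h; [case: no0|case: no1]; by exists q.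
Qed.

End ConnectedTrichotomy.

Theorem proposition2 (R : realType) (m : nat) (V Sigma : topologicalType)
    (M : manifold (R := R) 3 V m.+1) (g : lorentz_metric (k := 2) M)
    (H : hypersurface M Sigma) :
  connected [set: Sigma] -> umbilical g H -> constant_signature g H.
Proof.
move=> cS umb.
(* The function [nu] changes with [q0], since normals are only local. Stating the equivalences on a
   neighbourhood lets the openness of each causal type be read from the sign of one function. *)
have loc q0 : exists nu : Sigma -> R,
    [/\ nu @ nbhs q0 --> nu q0, nu q0 = 0 -> \forall q \near q0, nu q = 0 &
    \forall q \near q0, [/\ spacelike_at g H q <-> nu q < 0,
      timelike_at g H q <-> 0 < nu q & null_at g H q <-> nu q = 0]].
  have [U [n [F [[openU Uq0] nU umbU F_cts]]]] := umb q0.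
  have [d Hd dq0] := atlas_cover (hyp_manifold H) q0.
  have [c Mc cq0] := atlas_cover M (emb H q0).
  have dcq0 : charts_at H d c q0 by [].
  exists (fun q => conormal_norm g H c q (n c q)); split.
  - exact: conormal_norm_along_cts Uq0 nU dcq0.
  - exact: conormal_norm_along_vanishes openU Uq0 nU dcq0 umbU F_cts.
  have nearU : \forall q \near q0, [/\ U q, dom d q & dom c (emb H q)].
    near=> q; split.
    - by near: q; exact: open_nbhs_nbhs.
    - by near: q; apply: open_nbhs_nbhs; split=> //; exact: dom_open.
    - near: q; have := @emb_cts _ _ _ _ _ _ H q0; apply.
      by apply: open_nbhs_nbhs; split=> //; exact: dom_open.
  apply: filterS nearU => q [Uq dq cq].
  have dcq : charts_at H d c q by [].
  have [nN _ _] := nU; have nq := nN _ _ _ Uq dcq.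
  (* The causal predicates quantify over all charts and normals; this positive factor transfers the
     sign from the chosen pair to every other one. *)
  have sgn d' c' w : charts_at H d' c' q -> normal_covector H d' c' q w ->
      exists2 a : R, 0 < a & conormal_norm g H c' q w =
      (a * conormal_norm g H c q (n c q)).
    move=> dcq' wN.
    have [a a0 ->] := conormal_norm_chart (g := g) nU Uq dcq dcq' wN.
    by exists (a ^+ 2) => //; rewrite exprn_even_gt0.
  split; split=> [h|h]; try exact: h dcq nq.
  - move=> d' c' w dcq' wN; have [a a0 ->] := sgn _ _ _ dcq' wN.
    by rewrite pmulr_rlt0.
  - move=> d' c' w dcq' wN; have [a a0 ->] := sgn _ _ _ dcq' wN.
    by rewrite mulr_gt0.
  - move=> d' c' w dcq' wN; have [a a0 ->] := sgn _ _ _ dcq' wN.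
    by rewrite h mulr0.
apply: connected_trichotomy => // q0; have [nu [nuC nu0 nuP]] := loc q0;
  have [s0 t0 n0] := nbhs_singleton nuP.
- move=> /s0 nu_lt0; have near_lt : \forall q \near q0, nu q < 0.
    exact: cvgr_lt nuC _ nu_lt0.
  by apply: filterS2 nuP near_lt => q [sq _ _] /sq.
- move=> /t0 nu_gt0; have near_gt : \forall q \near q0, 0 < nu q.
    exact: cvgr_gt nuC _ nu_gt0.
  by apply: filterS2 nuP near_gt => q [_ tq _] /tq.
- by move=> /n0/nu0 near0; apply: filterS2 nuP near0 => q [_ _ nq] /nq.
- by case: (ltgtP (nu q0) 0) => [/s0|/t0|/n0];
    [exact: Or31|exact: Or32|exact: Or33].
- split; [|split] => -[].
  + by move=> /s0 lt0 /t0 /(lt_trans lt0); rewrite ltxx.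
  + by move=> /s0 + /n0 E; rewrite E ltxx.
  + by move=> /t0 + /n0 E; rewrite E ltxx.
Unshelve. all: by end_near. Qed.
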